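(* Let $0<\alpha<1$, $h>0$, $f:[0,\infty)\times\mathbb{R}^d\to\mathbb{R}^d$, and let $\{\omega_j\}_{j=0}^\infty$ be real weights satisfying: (i) $\omega_0>0$; (ii) $\omega_j\le 0$ for all $j\ge1$; (iii) $\sum_{j=0}^n\omega_j\ge0$ for every $n\ge1$. Let $\{x_n\}_{n\ge0}\subset\mathbb{R}^d$ be a solution of the scheme $\sum_{j=0}^n\omega_{n-j}x_j=h^\alpha f(t_n,x_n)$, $n=1,2,3,\dots$, where $t_n=nh$. Then $$\sum_{j=0}^{n}\omega_{n-j}\|x_j\|^2\le\Big\langle 2x_n,\ \sum_{j=0}^n\omega_{n-j}x_j\Big\rangle,\qquad n\ge1.$$
   Context: $\langle\cdot,\cdot\rangle$ and $\|\cdot\|$ are the standard inner product and norm on $\mathbb{R}^d$. *)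

(* Defs.v *)
From mathcomp Require Import all_boot all_order all_algebra.
From mathcomp Require Import reals exp.

Set Implicit Arguments.
Unset Strict Implicit.
Unset Printing Implicit Defensive.

Import GRing.Theory Num.Theory.
Local Open Scope ring_scope.

Definition dotr (R : realType) (d : nat) (u v : 'rV[R]_d) : R :=
  \sum_(i < d) u ord0 i * v ord0 i.

(* The Euclidean norm; the library's norm `|u| on 'rV[R]_d is the sup norm. *)
Definition norm2 (R : realType) (d : nat) (u : 'rV[R]_d) : R :=
  Num.sqrt (dotr u u).

(* Main.v *)
Require Import Defs.
From mathcomp Require Import all_boot all_order all_algebra.
From mathcomp Require Import reals exp.
From mathcomp Require Import ring.

Import Order.TTheory GRing.Theory Num.Theory.
Local Open Scope ring_scope.

(** By polarization, [2 <u, v> = |v|^2 + |u|^2 - |u - v|^2].  Taking [u = x n]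
    and [v = x j] and summing against the weights [omega (n - j)], the right-hand
    side exceeds the left-hand side by
      [(\sum_j omega j) * |x n|^2 - \sum_j omega (n - j) * |x n - x j|^2].
    The first term is nonnegative because the partial sums of the weights are;
    in the second sum the only positive weight, [omega 0], multiplies
    [|x n - x n|^2 = 0], so every term is nonpositive.  This estimate is
    [quadratic_convolution_le]; it rests on [dotr_polarization]. *)

Section DotProduct.

Variables (R : realType) (d : nat).
Implicit Types u v : 'rV[R]_d.

Lemma dotr_ge0 u : 0 <= dotr u u.
Proof. by apply: sumr_ge0 => i _; rewrite -expr2 sqr_ge0. Qed.

Lemma sqr_norm2 u : norm2 u ^+ 2 = dotr u u.
Proof. by rewrite /norm2 sqr_sqrtr // dotr_ge0. Qed.

Lemma dotr0 u : dotr u 0 = 0.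
Proof. by rewrite /dotr big1 // => i _; rewrite mxE mulr0. Qed.

Lemma dotr_sumr (n : nat) u (c : 'I_n -> R) (y : 'I_n -> 'rV[R]_d) :
  dotr u (\sum_(j < n) c j *: y j) = \sum_(j < n) c j * dotr u (y j).
Proof.
rewrite /dotr; under eq_bigr do rewrite summxE mulr_sumr.
rewrite exchange_big; apply: eq_bigr => j _; rewrite mulr_sumr.
by apply: eq_bigr => i _; rewrite mxE mulrCA.
Qed.

Lemma dotr_polarization u v :
  dotr (2 *: u) v = dotr v v + dotr u u - dotr (u - v) (u - v).
Proof.
rewrite /dotr -big_split -sumrB /=.
by apply: eq_bigr => i _; rewrite !mxE; ring.
Qed.

(** A discrete form of the convexity inequality for [|.|^2]: the nonpositive
    weights act on the past values [x j], [j < n], and the polarization defect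
    [|x n - x j|^2] vanishes at the present one. *)
Lemma quadratic_convolution_le (omega : nat -> R) (x : nat -> 'rV[R]_d)
    (n : nat) :
  (forall j : nat, (1 <= j)%N -> omega j <= 0) ->
  0 <= \sum_(j < n.+1) omega j ->
  \sum_(j < n.+1) omega (n - j)%N * norm2 (x j) ^+ 2
  <= dotr (2 *: x n) (\sum_(j < n.+1) omega (n - j)%N *: x j).
Proof.
move=> omega_le0 omega_sum_ge0; rewrite dotr_sumr -subr_ge0 -sumrB.
have -> : \sum_(j < n.+1) (omega (n - j)%N * dotr (2 *: x n) (x j)
            - omega (n - j)%N * norm2 (x j) ^+ 2)
    = (\sum_(j < n.+1) omega (n - j)%N) * dotr (x n) (x n)
      - \sum_(j < n.+1) omega (n - j)%N * dotr (x n - x j) (x n - x j).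
  rewrite mulr_suml -sumrB; apply: eq_bigr => j _.
  by rewrite dotr_polarization sqr_norm2; ring.
have -> : \sum_(j < n.+1) omega (n - j)%N = \sum_(j < n.+1) omega j.
  rewrite (reindex_inj rev_ord_inj) /=; apply: eq_bigr => j _.
  by rewrite subSS subKn // -ltnS.
rewrite subr_ge0; apply: (@le_trans _ _ 0); last first.
  by rewrite mulr_ge0 ?dotr_ge0.
apply: sumr_le0 => j _; have := ltn_ord j; rewrite ltnS leq_eqVlt.
(* The diagonal term [j = n] carries [omega 0] but has a null difference. *)
case/orP => [/eqP -> | lt_jn]; first by rewrite subrr dotr0 mulr0.
by rewrite mulr_le0_ge0 ?dotr_ge0 // omega_le0 // subn_gt0.
Qed.

End DotProduct.

Theorem lemma3p2 (R : realType) (d : nat) (alpha h : R)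
    (f : R -> 'rV[R]_d -> 'rV[R]_d) (omega : nat -> R) (x : nat -> 'rV[R]_d)
    (alpha_gt0 : 0 < alpha) (alpha_lt1 : alpha < 1) (h_gt0 : 0 < h)
    (omega0_gt0 : 0 < omega 0%N)
    (omega_le0 : forall j : nat, (1 <= j)%N -> omega j <= 0)
    (omega_sum_ge0 : forall n : nat, (1 <= n)%N ->
      0 <= \sum_(j < n.+1) omega j)
    (scheme : forall n : nat, (1 <= n)%N ->
      \sum_(j < n.+1) omega (n - j)%N *: x j
      = (h `^ alpha) *: f (n%:R * h) (x n)) :
  forall n : nat, (1 <= n)%N ->
    \sum_(j < n.+1) omega (n - j)%N * norm2 (x j) ^+ 2
    <= dotr (2 *: x n) (\sum_(j < n.+1) omega (n - j)%N *: x j).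
Proof.
by move=> n n_ge1; apply: quadratic_convolution_le => //; apply: omega_sum_ge0.
Qed.
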